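(* Let $k\ge 1$ be an integer, let $N=3k$, and let $T_N$ be the triangular region in the hexagonal lattice with $3k$ hexagons on each side. Then $T_N$ admits a $\mathbb{Z}_3$-symmetric signed tiling by tribones (three-in-line polyominoes) if and only if $k=9r$ for some integer $r$. The first such triangle is $T_{27}$.
   Context: Consider the tiling of the plane by regular hexagons (the hexagonal lattice). Identify each hexagon with its center, and let $u,v$ be two translation vectors of the tiling taking a hexagon to adjacent hexagons, with angle $60^\circ$ between them; the hexagon centers are then $h_0+iu+jv$, $i,j\in\mathbb{Z}$, for a base center $h_0$. The triangular region $T_N$ is the set of hexagons with centers $h_0+iu+jv$, $i,j\ge 0$, $i+j\le N-1$; it has $N$ hexagons on each side. Since $N=3k$, the center of the triangle is a vertex of the hexagonal tiling, and the rotation $\rho$ of the plane through $120^\circ$ about this center preserves the hexagonal tiling and $T_N$. The group generated by $\rho$ is $\mathbb{Z}_3$; no hexagon is fixed by it. A tribone (three-in-line polyomino) is a set of three consecutive hexagons in a line, i.e. hexagons with centers $p-w,\ p,\ p+w$, where $p$ is any hexagon center and $w\in\{u,v,u-v\}$. Tribones are not required to be contained in $T_N$. A signed tiling of $T_N$ by tribones is a finitely supported function $\omega$ from the set of all tribones to $\mathbb{Z}$ such that, for each hexagon $h$ of the plane, $\sum_{T\ni h}\omega(T)$ equals $1$ if $h\in T_N$ and $0$ otherwise. The signed tiling is $\mathbb{Z}_3$-symmetric if $\omega(\rho(T))=\omega(T)$ for every tribone $T$. *)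

(* Defs.v *)
From HB Require Import structures.
From mathcomp Require Import all_boot all_order all_algebra.
From mathcomp Require Import finmap ring.

Set Implicit Arguments.
Unset Strict Implicit.
Unset Printing Implicit Defensive.

Import Order.TTheory GRing.Theory Num.Theory.
Local Open Scope fset_scope.
Local Open Scope ring_scope.

(* The pair (i, j) stands for the hexagon with center h0 + i u + j v. *)
Notation hex := (int * int)%type.

Definition u : hex := (1, 0).
Definition v : hex := (0, 1).

Definition triangle (N : nat) : pred hex :=
  fun h => [&& 0 <= h.1, 0 <= h.2 & h.1 + h.2 <= N%:Z - 1].

(* The rotation through 120 degrees about the center of the triangle, in the
   coordinates (i, j): its linear part maps u to v - u and v to - u, and it
   sends the corner (0, 0) to (N - 1, 0). See [rotE]. *)
Definition rot (N : nat) (h : hex) : hex := (N%:Z - 1 - h.1 - h.2, h.1).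

Section Plane.
Variable C : numClosedFieldType.

Definition zeta6 : C := (1 + 'i * sqrtC 3%:R) / 2%:R.

Definition center (h0 u0 : C) (h : hex) : C :=
  h0 + h.1%:~R * u0 + h.2%:~R * (zeta6 * u0).

Definition centroid (h0 u0 : C) (N : nat) : C :=
  (center h0 u0 (0, 0) + center h0 u0 (N%:Z - 1, 0)
     + center h0 u0 (0, N%:Z - 1)) / 3%:R.

Lemma zeta6_sqr : zeta6 ^+ 2 = zeta6 - 1.
Proof.
rewrite /zeta6 expr_div_n sqrrD expr1n mul1r exprMn sqrCi sqrtCK.
by field.
Qed.

Lemma rotE h0 u0 N h :
  center h0 u0 (rot N h) - centroid h0 u0 N
    = zeta6 ^+ 2 * (center h0 u0 h - centroid h0 u0 N).
Proof.
rewrite /centroid /center /rot /=.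
have -> : zeta6 ^+ 2 = zeta6 - 1 := zeta6_sqr.
rewrite !rmorphB /= rmorph1 rmorph0.
have := zeta6_sqr; set z := zeta6; set n : C := N%:~R.
set a : C := h.1%:~R; set b : C := h.2%:~R => zz.
have {}zz : z * z = z - 1 by rewrite -expr2.
apply/eqP; rewrite -subr_eq0; apply/eqP.
transitivity ((z * z - (z - 1)) * (- b * u0 + (n - 1) / 3%:R * u0)).
  by field.
by rewrite zz subrr mul0r.
Qed.

End Plane.

Definition line3 (p w : hex) : {fset hex} := [fset p - w; p; p + w].

Definition directions : seq hex := [:: u; v; u - v].

(* The search for p is restricted to T to make the predicate boolean; this is
   harmless because p belongs to [line3 p w]. See [is_triboneP]. *)
Definition is_tribone (T : {fset hex}) : bool :=
  has (fun w => has (fun p => T == line3 p w) (enum_fset T)) directions.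

Lemma is_triboneP T :
  reflect (exists p w, w \in directions /\ T = line3 p w) (is_tribone T).
Proof.
apply: (iffP hasP) => [[w wD /hasP[p _ /eqP TE]]|[p [w [wD ->]]]].
  by exists p, w.
exists w => //; apply/hasP; exists p => //.
by rewrite /line3 !inE eqxx orbT.
Qed.

Record tribone := Tribone { cells : {fset hex}; _ : is_tribone cells }.

HB.instance Definition _ := [isSub for cells].
HB.instance Definition _ := [Choice of tribone by <:].

Lemma is_tribone_rot N (T : tribone) : is_tribone (rot N @` cells T).
Proof.
case: T => /= T /is_triboneP[p [w [wD ->]]]; apply/is_triboneP.
have rotl q d : rot N (q + d) = rot N q + (- d.1 - d.2, d.1).
  by case: q d => [a b] [c d]; rewrite /rot; congr pair => /=; ring.
have imE d : rot N @` line3 p d = line3 (rot N p) (- d.1 - d.2, d.1).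
  rewrite /line3 !imfsetU !imfset_fset1 !rotl /=; congr ([fset _; _; _]).
  by congr (_ + _); congr pair => /=; ring.
have lineN q d : line3 q (- d) = line3 q d.
  rewrite /line3 opprK; apply/fsetP => x; rewrite !inE.
  by rewrite orbC orbA [X in X || _]orbC -!orbA; do !bool_congr.
move: wD; rewrite !inE => /or3P[] /eqP ->.
- by exists (rot N p), (u - v); split; rewrite ?inE ?eqxx ?orbT // imE -[RHS]lineN.
- by exists (rot N p), u; split; rewrite ?inE ?eqxx // imE -[RHS]lineN.
- by exists (rot N p), v; split; rewrite ?inE ?eqxx ?orbT // imE.
Qed.

Definition rot_tribone (N : nat) (T : tribone) : tribone :=
  Tribone (is_tribone_rot N T).

Definition signed_tiling (N : nat) (omega : {fsfun tribone -> int with 0}) : Prop :=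
  forall h : hex,
    \sum_(T <- finsupp omega | h \in cells T) omega T
      = (if triangle N h then 1 else 0).

Definition Z3_symmetric (N : nat) (omega : {fsfun tribone -> int with 0}) : Prop :=
  forall T : tribone, omega (rot_tribone N T) = omega T.

Definition Z3_signed_tileable (N : nat) : Prop :=
  exists omega : {fsfun tribone -> int with 0},
    signed_tiling N omega /\ Z3_symmetric N omega.

(* Main.v *)
(** Three times the squared distance of a hexagon to the center of the triangle
    defines an integral weight. It is invariant under the rotation, and the
    weights of the cells of a tribone add up to 9 (q + 1), where 3 q + 1 is the
    weight of the middle cell. The rotation permutes the three directions
    freely, so a symmetric tiling is three times a sum over horizontal tribones
    as far as weights are concerned, and the total weight of the triangle is a
    multiple of 27. One representative of each orbit in the triangle contributes
    k (9 k^2 - 1) (3 k + 2) / 8 in all, whence 9 | k.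

    Conversely, modulo orbits of horizontal tribones, the orbit of a hexagon is
    its weight times the orbit of the hexagon (k, k) next to the center, and
    this orbit is killed by 9: the tribones near the center already show it.
    Thus the triangle is tileable as soon as 9 divides the sum above. *)

Require Import Defs.
From HB Require Import structures.
From mathcomp Require Import all_boot all_order all_algebra.
From mathcomp Require Import finmap zify ring.
Import Defs.

Set Implicit Arguments.
Unset Strict Implicit.
Unset Printing Implicit Defensive.

Import Order.TTheory GRing.Theory Num.Theory.
Local Open Scope fset_scope.
Local Open Scope ring_scope.

Lemma sum_fset_delta (K : choiceType) (A : {fset K}) (f : K -> int) x :
  x \in A -> \sum_(y <- A) f y * (y == x)%:Z = f x.
Proof.
move=> xA; rewrite (big_fsetD1 x xA) /= eqxx mulr1 big1_fset ?addr0 // => y.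
by rewrite !inE => /andP[/negPf-> _] _; rewrite mulr0.
Qed.

(** * The rotation acting on hexagons and tribones *)

Lemma rotK3 N h : rot N (rot N (rot N h)) = h.
Proof. by case: h => a b; rewrite /rot /=; congr pair; ring. Qed.

Lemma rot_inj N : injective (rot N).
Proof. exact: (can_inj (g := fun h => rot N (rot N h)) (rotK3 N)). Qed.

Lemma eq_rotl N h q : (h == rot N q) = (rot N (rot N h) == q).
Proof. by rewrite -[q in RHS](rotK3 N) !(inj_eq (@rot_inj N)). Qed.

Lemma eq_rotr N h q : (rot N h == q) = (h == rot N (rot N q)).
Proof. by rewrite !eq_rotl rotK3. Qed.

Lemma mem_rot_tribone N T h :
  (h \in cells (rot_tribone N T)) = (rot N (rot N h) \in cells T).
Proof. by rewrite -{1}[h](rotK3 N) /= (mem_imfset _ _ (@rot_inj N)). Qed.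

Lemma rot_triboneK3 N T : rot_tribone N (rot_tribone N (rot_tribone N T)) = T.
Proof.
by apply/val_inj/fsetP => h; rewrite !mem_rot_tribone !rotK3.
Qed.

Lemma rot_tribone_inj N : injective (rot_tribone N).
Proof.
exact: (can_inj (g := fun T => rot_tribone N (rot_tribone N T))
                (rot_triboneK3 N)).
Qed.

(** * Horizontal tribones and symmetric sums *)

Definition horizontal (T : tribone) : bool :=
  all (fun h => all (fun h' => h.2 == h'.2) (cells T)) (cells T).

Lemma horizontalP T :
  reflect {in cells T &, forall h h', h.2 = h'.2} (horizontal T).
Proof.
apply: (iffP allP) => H h.
  by move=> h' hT h'T; have /allP/(_ _ h'T)/eqP := H _ hT.
by move=> hT; apply/allP => h' h'T; apply/eqP/H.
Qed.

Lemma mem_line3 (h p w : hex) :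
  (h \in line3 p w) = [|| h == p - w, h == p | h == p + w].
Proof. by rewrite /line3 !inE -orbA. Qed.

(** Up to sign, the linear part of the rotation permutes the directions cyclically: [v] goes to [u],
    [u] to [u - v], and [u - v] to [v]. *)
Lemma horizontal_rot N T :
  (horizontal T + horizontal (rot_tribone N T)
    + horizontal (rot_tribone N (rot_tribone N T)) = 1)%N.
Proof.
have /is_triboneP[p [w [wD TE]]] := valP T.
have mT h : (h \in cells T) = [|| h == p - w, h == p | h == p + w].
  by rewrite [cells T]TE mem_line3.
have pT : p \in cells T by rewrite mT eqxx orbT.
have qT : p + w \in cells T by rewrite mT eqxx !orbT.
have Eh T' (c : bool) :
    ({in cells T' &, forall h h', h.2 = h'.2} <-> c) -> horizontal T' = c.
  by move=> E; apply/horizontalP/idP => /E.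
have -> : horizontal T = (w == u).
  apply: Eh; split=> [/(_ _ _ pT qT)|/eqP wu].
    by move: wD; rewrite !inE => /or3P[] /eqP -> //=;
      case: p {mT pT qT TE} => a b /=; lia.
  move=> h h'; rewrite !mT wu => /or3P[]/eqP-> /or3P[]/eqP->;
    by case: p {mT pT qT TE} => a b /=; lia.
have -> : horizontal (rot_tribone N T) = (w == v).
  apply: Eh; split=> [/(_ (rot N p) (rot N (p + w)))|/eqP wv].
    rewrite !mem_rot_tribone !rotK3 pT qT => /(_ isT isT).
    by move: wD; rewrite !inE => /or3P[] /eqP -> //=;
      case: p {mT pT qT TE} => a b /=; lia.
  move=> _ _ /imfsetP[h /= + ->] /imfsetP[h' /= + ->].
  rewrite !mT wv => /or3P[]/eqP-> /or3P[]/eqP->;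
    by case: p {mT pT qT TE} => a b /=; lia.
have -> : horizontal (rot_tribone N (rot_tribone N T)) = (w == u - v).
  apply: Eh; split=> [/(_ (rot N (rot N p)) (rot N (rot N (p + w))))|/eqP wv].
    rewrite !mem_rot_tribone !rotK3 pT qT => /(_ isT isT).
    by move: wD; rewrite !inE => /or3P[] /eqP -> //=;
      case: p {mT pT qT TE} => a b /=; lia.
  move=> _ _ /imfsetP[_ /imfsetP[h /= + ->] ->]
    /imfsetP[_ /imfsetP[h' /= + ->] ->].
  rewrite !mT wv => /or3P[]/eqP-> /or3P[]/eqP->;
    by case: p {mT pT qT TE} => a b /=; lia.
by move: wD; rewrite !inE => /or3P[] /eqP ->.
Qed.

(** Rotating the summation index shows that the indicators of [T], its rotate and its second rotate
    being horizontal contribute equally; by [horizontal_rot] they add up to 1. *)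
Lemma Z3_symmetric_sum N (omega : {fsfun tribone -> int with 0})
    (g : tribone -> int) :
    Z3_symmetric N omega -> (forall T, g (rot_tribone N T) = g T) ->
  \sum_(T <- finsupp omega) omega T * g T
    = 3 * \sum_(T <- finsupp omega) omega T * g T * (horizontal T)%:Z.
Proof.
move=> sym grot; set s := finsupp omega.
have srot : perm_eq [seq rot_tribone N T | T <- s] s.
  apply: uniq_perm; rewrite ?map_inj_uniq ?fset_uniq //.
    exact: rot_tribone_inj.
  move=> T; rewrite -{1}[T](rot_triboneK3 N) mem_map;
    last exact: rot_tribone_inj.
  by rewrite !mem_finsupp !sym.
have reindex (d : tribone -> int) :
    \sum_(T <- s) omega T * g T * d T
      = \sum_(T <- s) omega T * g T * d (rot_tribone N T).
  rewrite -(perm_big _ srot) big_map.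
  by apply: eq_bigr => T _; rewrite sym grot.
pose hz T := (horizontal T)%:Z.
transitivity (\sum_(T <- s) omega T * g T *
    (hz T + hz (rot_tribone N T) + hz (rot_tribone N (rot_tribone N T)))).
  by apply: eq_bigr => T _; rewrite /hz -!PoszD horizontal_rot mulr1.
under eq_bigr do rewrite !mulrDr.
rewrite !big_split /= -(reindex (fun T => hz (rot_tribone N T))) -(reindex hz).
by rewrite /hz; ring.
Qed.

(** * Orbits and the invariant weight *)

Definition orb (N : nat) (q h : hex) : int :=
  (h == q)%:Z + (rot N h == q)%:Z + (rot N (rot N h) == q)%:Z.

Lemma orb_rot N q h : orb N (rot N q) h = orb N q h.
Proof.
rewrite /orb !eq_rotl !rotK3; ring.
Qed.

(* Three times the squared distance to the center of the triangle, which has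
   coordinates (k - 1/3, k - 1/3). *)
Definition weight (k : nat) (h : hex) : int :=
  let a := h.1 - k%:Z in let b := h.2 - k%:Z in
  1 + 3 * (a * a + a * b + b * b + a + b).

Lemma weight_rot k h : weight k (rot (3 * k) h) = weight k h.
Proof. by case: h => a b; rewrite /weight /rot /= PoszM; ring. Qed.

Lemma sum_line3 (f : hex -> int) p w : w \in directions ->
  \sum_(h <- line3 p w) f h = f (p - w) + f p + f (p + w).
Proof.
move=> wD; rewrite (perm_big [:: p - w; p; p + w]) /=.
  by rewrite !big_cons big_nil; ring.
apply: uniq_perm => [||h]; rewrite ?fset_uniq ?mem_line3 ?inE //=.
rewrite !inE; move: wD; rewrite !inE => /or3P[]/eqP->; case: p => a b;
  rewrite !xpair_eqE /=; lia.
Qed.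

(** Linear terms cancel around [p], and the form [a * a + a * b + b * b] is 1 on each direction, so
    the sum is three times the middle weight plus 6. *)
Lemma weight_line3 k p w : w \in directions ->
  exists z : int, weight k (p - w) + weight k p + weight k (p + w) = 9 * z.
Proof.
pose a := p.1 - k%:Z; pose b := p.2 - k%:Z => wD.
exists (a * a + a * b + b * b + a + b + 1).
move: wD; rewrite !inE => /or3P[]/eqP-> /=; rewrite /weight {}/a {}/b;
  by case: p => x y /=; ring.
Qed.

Lemma weight_tribone k T :
  exists z : int, \sum_(h <- cells T) weight k h = 9 * z.
Proof.
have /is_triboneP[p [w [wD ->]]] := valP T.
by rewrite sum_line3 //; apply: weight_line3.
Qed.

Lemma weight_rot_tribone k T :
  \sum_(h <- cells (rot_tribone (3 * k) T)) weight k h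
    = \sum_(h <- cells T) weight k h.
Proof.
rewrite big_imfset /=; last by move=> h h' _ _ /rot_inj.
by apply: eq_bigr => h _; rewrite weight_rot.
Qed.

(** * Representatives of the orbits in the triangle *)

Definition fund_domain (k : nat) : seq hex :=
  [seq (k%:Z - 1 - l%:Z + i%:Z, k%:Z - 1 - l%:Z)
     | l <- iota 0 k, i <- iota 0 (3 * l + 2)].

Lemma mem_fund_domain k h :
  (h \in fund_domain k)
    = [&& 0 <= h.2, h.2 <= h.1 & h.1 + 2 * h.2 < 3 * k%:Z - 1].
Proof.
apply/allpairsPdep/idP => [[l [i [+ + ->]]]|].
  rewrite !mem_iota /=; lia.
case: h => a b /= H; exists (k - 1 - `|b|)%N, `|a - b|%N.
rewrite !mem_iota /=; split; try lia; congr pair; lia.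
Qed.

Lemma fund_domain_uniq k : uniq (fund_domain k).
Proof.
apply: allpairs_uniq_dep => [|l _|]; rewrite ?iota_uniq //.
move=> [l i] [l' i'] _ _ /= [E1 E2].
have El : l = l' by lia.
by rewrite El in E1 *; congr existT; lia.
Qed.

(** The rotation cyclically permutes [(a, b, c)] with [c = 3 k - 1 - a - b], and the domain asks for
    [0 <= b], [b <= a] and [b < c]. As [3 k - 1] is no multiple of 3, the coordinates are never all
    equal, so exactly one rotate satisfies the last two conditions. *)
Lemma triangle_orb k h :
  (triangle (3 * k) h)%:Z = \sum_(r <- fund_domain k) orb (3 * k) r h.
Proof.
have delta x : \sum_(r <- fund_domain k) (x == r)%:Z = (x \in fund_domain k)%:Z.
  rewrite -(count_uniq_mem _ (fund_domain_uniq k)) -sum1_count.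
  rewrite [in RHS]big_mkcond /=.
  rewrite (big_morph Posz PoszD (erefl _)); apply: eq_bigr => r _.
  by rewrite eq_sym; case: eqP.
rewrite !big_split /= !delta !mem_fund_domain /triangle.
case: h => a b; rewrite /rot /= PoszM; lia.
Qed.

Lemma sum_weight_fund_domain k :
  8 * \sum_(r <- fund_domain k) weight k r
    = k%:Z * (9 * k%:Z * k%:Z - 1) * (3 * k%:Z + 2).
Proof.
(* The weight depends only on the position relative to [(k, k)], so the row at height [k - 1 - l]
   moves to height 0 with [l.+1] in place of [k]. *)
pose f (l i : nat) := weight l.+1 (i%:Z, 0).
have -> : \sum_(r <- fund_domain k) weight k r
    = \sum_(0 <= l < k) \sum_(0 <= i < 3 * l + 2) f l i.
  rewrite big_allpairs_dep /index_iota subn0; apply: eq_bigr => l _.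
  rewrite subn0; apply: eq_bigr => i _; rewrite /f /weight /= !intS; ring.
(* An arbitrary length [n] permits induction; the domain needs [n = 3 * l + 2]. *)
have row l n : 2 * \sum_(0 <= i < n) f l i
    = n%:Z * (2 * n%:Z * n%:Z - 9 * l.+1%:Z * n%:Z
        + 18 * l.+1%:Z * l.+1%:Z - 3 * l.+1%:Z).
  elim: n => [|n IHn]; first by rewrite big_nil; ring.
  rewrite big_nat_recr //= mulrDr IHn /f /weight /= !intS; ring.
elim: k => [|k IHk]; first by rewrite big_nil; ring.
rewrite big_nat_recr //= mulrDr IHk.
have -> x : 8 * x = 4 * (2 * x) :> int by ring.
rewrite row PoszD PoszM !intS; ring.
Qed.

(** * Necessity: divisibility of the total weight *)

Lemma sum_weight_cover k (omega : {fsfun tribone -> int with 0}) :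
    signed_tiling (3 * k) omega ->
  3 * \sum_(r <- fund_domain k) weight k r
    = \sum_(T <- finsupp omega) omega T * \sum_(h <- cells T) weight k h.
Proof.
move=> tiling; set D := fund_domain k; pose rho := rot (3 * k).
pose E := [fset h in [seq rho h | h <- D] ++ [seq rho (rho h) | h <- D] ++ D].
(* [H] holds every cell of the support and every orbit of the domain, so summing the weighted tiling
   identity over [H] loses nothing on either side. *)
pose H := \bigcup_(T <- finsupp omega) cells T `|` E.
transitivity (\sum_(h <- H) weight k h * (triangle (3 * k) h)%:Z).
  under [RHS]eq_bigr do rewrite triangle_orb mulr_sumr.
  rewrite exchange_big mulr_sumr /= big_seq [RHS]big_seq.
  apply: eq_bigr => r rD; under eq_bigr do rewrite !mulrDr eq_rotr -eq_rotl.
  rewrite !big_split /=.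
  rewrite !sum_fset_delta ?weight_rot; [ring|..]; apply/fsetUP; right;
    rewrite in_fset !mem_cat.
  - by rewrite (map_f rho rD).
  - by rewrite (map_f (fun h => rho (rho h)) rD) !orbT.
  - by rewrite rD !orbT.
transitivity (\sum_(h <- H) weight k h *
    \sum_(T <- finsupp omega | h \in cells T) omega T).
  by apply: eq_bigr => h _; rewrite tiling; case: triangle.
under eq_bigr do rewrite mulr_sumr big_mkcond.
rewrite exchange_big /= big_seq [RHS]big_seq; apply: eq_bigr => T TS.
have TH : cells T `<=` H.
  by apply: fsubset_trans (fsubsetUl _ _); apply: bigfcup_sup.
rewrite -(big_fset_incl _ TH) => [|h _ /negPf-> //].
rewrite mulr_sumr big_seq [RHS]big_seq.
by apply: eq_bigr => h ->; rewrite mulrC.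
Qed.

Lemma tileable_weight k :
  Z3_signed_tileable (3 * k) ->
  exists z : int, \sum_(r <- fund_domain k) weight k r = 9 * z.
Proof.
case=> omega [tiling sym].
have E := sum_weight_cover tiling.
(* The factor 3 from symmetry will cancel the 3 from the orbits, leaving a combination of multiples
   of 9. *)
rewrite (Z3_symmetric_sum sym (weight_rot_tribone k)) in E.
have [z Ez] : exists z : int, \sum_(T <- finsupp omega)
    omega T * (\sum_(h <- cells T) weight k h) * (horizontal T)%:Z = 9 * z.
  elim/big_rec: _ => [|T x _ [z ->]]; first by exists 0.
  have [y ->] := weight_tribone k T.
  exists (omega T * y * (horizontal T)%:Z + z); ring.
exists z; lia.
Qed.

(** * Sufficiency: tilings from orbits of horizontal tribones *)

Definition orb3 (N : nat) (p h : hex) : int :=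
  orb N (p - u) h + orb N p h + orb N (p + u) h.

Definition orb3_span (N : nat) (g : hex -> int) : Prop :=
  exists s : seq (int * hex), forall h, g h = \sum_(x <- s) x.1 * orb3 N x.2 h.

Lemma orb3_span_lin N a f g h :
    orb3_span N f -> orb3_span N g -> (forall x, h x = a * f x + g x) ->
  orb3_span N h.
Proof.
move=> [s Ef] [t Eg] Eh; exists ([seq (a * x.1, x.2) | x <- s] ++ t) => x.
rewrite Eh Ef Eg big_cat big_map mulr_sumr /=.
by congr (_ + _); apply: eq_bigr => y _; rewrite mulrA.
Qed.

Lemma orb3_span0 N : orb3_span N (fun=> 0).
Proof. by exists [::] => h; rewrite big_nil. Qed.

Lemma is_tribone_line3 p : is_tribone (line3 p u).
Proof. by apply/is_triboneP; exists p, u; rewrite inE eqxx. Qed.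

(** [orb3 N p] is the covering by the three rotates of the horizontal tribone centered at [p];
    giving all three the same coefficient makes the tiling symmetric. *)
Lemma orb3_span_tileable N :
  orb3_span N (fun h => (triangle N h)%:Z) -> Z3_signed_tileable N.
Proof.
case=> s Es; pose H p := Tribone (is_tribone_line3 p).
pose rho := rot_tribone N.
pose c T T0 : int := (T == T0)%:Z + (T == rho T0)%:Z + (T == rho (rho T0))%:Z.
pose W T := \sum_(x <- s) x.1 * c T (H x.2).
have c_rot T T0 : c (rho T) T0 = c T T0.
  rewrite /c -{1}[T0](rot_triboneK3 N) !(inj_eq (@rot_tribone_inj N)); ring.
pose A := [fset T in flatten
  [seq [:: H x.2; rho (H x.2); rho (rho (H x.2))] | x <- s]].
have inA x T : x \in s -> T \in [:: H x.2; rho (H x.2); rho (rho (H x.2))] ->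
    T \in A.
  by move=> xs xT; rewrite in_fset; apply/flatten_mapP; exists x.
have WA T : T \notin A -> W T = 0.
  move=> TA; rewrite /W big_seq big1 // => x xs.
  have := contra (inA x T xs) TA.
  rewrite !inE !negb_or => /and3P[/negPf a1 /negPf a2 /negPf a3].
  by rewrite /c a1 a2 a3 mulr0.
(* By [WA], the default value 0 outside [A] is the value of [W] there. *)
pose omega : {fsfun tribone -> int with 0} := [fsfun T in A => W T].
have omegaE T : omega T = W T.
  by rewrite fsfunE; case: ifPn => // /WA.
exists omega; split=> [h|T]; last first.
  by rewrite !omegaE; apply: eq_bigr => x _; rewrite c_rot.
transitivity (\sum_(T <- A) (h \in cells T)%:Z * W T).
  rewrite big_mkcond /= (big_fset_incl _ (B := A)).
  - by apply: eq_bigr => T _; rewrite omegaE; case: ifP; rewrite ?mul1r ?mul0r.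
  - apply/fsubsetP => T; apply: contraTT => /WA T0.
    by rewrite mem_finsupp omegaE T0 eqxx.
  - by move=> T _; rewrite mem_finsupp negbK => /eqP->; case: ifP.
rewrite (_ : (if _ then _ else _) = (triangle N h)%:Z); last by case: triangle.
rewrite Es; under eq_bigr do rewrite mulr_sumr.
rewrite exchange_big /= big_seq [RHS]big_seq; apply: eq_bigr => x xs.
under eq_bigr do rewrite mulrCA.
rewrite -mulr_sumr; congr (_ * _); under eq_bigr do rewrite !mulrDr.
rewrite !big_split /= !sum_fset_delta;
  try by apply: (inA x) => //; rewrite !inE eqxx ?orbT.
have mH q : (q \in cells (H x.2))%:Z
    = (q == x.2 - u)%:Z + (q == x.2)%:Z + (q == x.2 + u)%:Z.
  rewrite mem_line3; case: x.2 q => a b [d e]; rewrite !xpair_eqE /=; lia.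
by rewrite !mem_rot_tribone rotK3 !mH /orb3 /orb; ring.
Qed.

(** * Reduction of every orbit to that of [(k, k)] *)

Definition orb_equiv (k : nat) (p : hex) (n : int) : Prop :=
  orb3_span (3 * k) (fun h => orb (3 * k) p h - n * orb (3 * k) (k%:Z, k%:Z) h).

Lemma orb_equiv_rot k p n : orb_equiv k (rot (3 * k) p) n -> orb_equiv k p n.
Proof. by case=> s Es; exists s => h; rewrite -Es orb_rot. Qed.

(** The sum over three consecutive cells of a row is an [orb3], so two of them determine the third.
    The permutation lets the unknown cell be an end or the middle. *)
Lemma orb_equiv_row k (m i0 i1 i2 j : int) a b :
    perm_eq [:: i0; i1; i2] [:: m - 1; m; m + 1] ->
  orb_equiv k (i0, j) a -> orb_equiv k (i1, j) b ->
  orb_equiv k (i2, j) (- a - b).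
Proof.
move=> i_row q0 q1; pose o i h := orb (3 * k) (i, j) h.
have row_span : orb3_span (3 * k) (fun h => o i0 h + o i1 h + o i2 h).
  exists [:: (1, (m, j))] => h; rewrite big_seq1 mul1r /orb3.
  rewrite (_ : _ - u = (m - 1, j)); last by congr pair => /=; ring.
  rewrite (_ : _ + u = (m + 1, j)); last by congr pair => /=; ring.
  have : \sum_(i <- [:: i0; i1; i2]) o i h
      = \sum_(i <- [:: m - 1; m; m + 1]) o i h := perm_big _ i_row.
  by rewrite !big_cons !big_nil !addr0 !addrA.
apply: (orb3_span_lin (a := -1) q0).
  by apply: (orb3_span_lin (a := -1) q1 row_span).
by move=> h /=; rewrite /o; ring.
Qed.

Lemma orb_equiv_center k : orb_equiv k (k%:Z, k%:Z) 1.
Proof. by exists [::] => h; rewrite big_nil mul1r subrr. Qed.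

(** The hexagon [(k + 1, k - 1)] gets the multiple 4 by rotation and -5 along its row; the
    difference is 9. *)
Lemma orb3_span_9orb k :
  orb3_span (3 * k) (fun h => 9 * orb (3 * k) (k%:Z, k%:Z) h).
Proof.
pose C (i j : int) := orb_equiv k (k%:Z + i, k%:Z + j).
have rotC i j i' n : i' = - 1 - i - j -> C i' i n -> C i j n.
  move=> -> H; apply: orb_equiv_rot.
  rewrite (_ : rot _ _ = (k%:Z + (- 1 - i - j), k%:Z + i)) //.
  by rewrite /rot /= PoszM; congr pair; ring.
have rowC m i0 i1 i2 j a b n : perm_eq [:: i0; i1; i2] [:: m - 1; m; m + 1] ->
    n = - a - b -> C i0 j a -> C i1 j b -> C i2 j n.
  move=> /(perm_map (+%R k%:Z)) /=; rewrite !addrA => i_row ->.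
  exact: orb_equiv_row i_row.
have C00 : C 0 0 1 by rewrite /C addr0; apply: orb_equiv_center.
have Ca : C 0 (-1) 1 by apply: rotC C00.
have Cb : C (-1) 0 1 by apply: rotC Ca.
have Cc : C 1 0 (-2) by apply: (rowC 0) Cb C00.
have Cd : C (-2) 0 (-2) by apply: (rowC (-1)) C00 Cb.
have Ce : C 0 1 (-2) by apply: rotC Cd.
have Cf : C (-2) 1 (-2) by apply: rotC (rotC _ _ _ _ _ Cc).
have Cg : C (-1) 1 4 by apply: (rowC (-1)) Cf Ce.
have Ch : C 1 (-1) 4 by apply: rotC Cg.
have Ci : C (-1) (-1) 4 by apply: rotC Ch.
have Cj : C 1 (-1) (-5) by apply: (rowC 0) Ci Ca.
apply: (orb3_span_lin (a := -1) Ch Cj) => h; ring.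
Qed.

Lemma int_bidir_ind (P : int -> Prop) :
  P 0 -> (forall i, P i <-> P (i + 1)) -> forall i, P i.
Proof.
move=> P0 PS; elim/int_rect=> // n; first by rewrite intS addrC -PS.
by rewrite [X in _ -> X]PS (_ : - n.+1%:Z + 1 = - n%:Z) //; lia.
Qed.

(** Modulo 9, weights obey the same recursion along rows as orbits. Two adjacent cells thus settle a
    row, and the rotation carries columns to rows. *)
Lemma orb_equiv_weight k p : orb_equiv k p (weight k p).
Proof.
pose W i j := orb_equiv k (i, j) (weight k (i, j)).
suff: W p.1 p.2 by case: p.
have W_rot i j : W (3 * k%:Z - 1 - i - j) i -> W i j.
  have -> : 3 * k%:Z - 1 - i - j = (rot (3 * k) (i, j)).1 by rewrite /= PoszM.
  by move=> H; apply: orb_equiv_rot; rewrite -weight_rot.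
have W_line m i0 i1 i2 j : perm_eq [:: i0; i1; i2] [:: m - 1; m; m + 1] ->
    W i0 j -> W i1 j -> W i2 j.
  move=> i_row W0 W1; have [z Ez] := @weight_line3 k (m, j) u isT.
  (* The row relation gives the third weight minus [9 * z]; the excess is absorbed by
     [orb3_span_9orb]. *)
  apply: (orb3_span_lin (a := - z) (orb3_span_9orb k)
    (orb_equiv_row i_row W0 W1)).
  have : \sum_(i <- [:: i0; i1; i2]) weight k (i, j)
      = \sum_(i <- [:: m - 1; m; m + 1]) weight k (i, j) := perm_big _ i_row.
  move: Ez.
  rewrite (_ : _ - u = (m - 1, j)); last by congr pair => /=; ring.
  rewrite (_ : _ + u = (m + 1, j)); last by congr pair => /=; ring.
  rewrite !big_cons !big_nil !addr0 => Ezm Ew h.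
  have -> : weight k (i2, j) = 9 * z - weight k (i0, j) - weight k (i1, j).
    lia.
  ring.
have W_row i j : W i j -> W (i + 1) j -> forall i', W i' j.
  move=> W0 W1 i'; suff [] : W (i + (i' - i)) j /\ W (i + (i' - i) + 1) j.
    by rewrite addrC subrK.
  elim/int_bidir_ind: (i' - i) => [|n]; first by rewrite addr0.
  rewrite addrA; set m := i + n.
  split=> -[Wa Wb]; split=> //.
    by apply: (W_line (m + 1)) Wa Wb; rewrite addrK.
  by apply: (W_line (m + 1)) Wb Wa; rewrite addrK;
    exact/permPl/(perm_rev [:: _; _; _]).
pose K := k%:Z.
have WK : W K K.
  apply: (orb3_span_lin (a := 0) (orb3_span0 _) (orb_equiv_center k)) => h.
  by rewrite /weight /= /K !subrr; ring.
have WK0 : W K (K - 1).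
  by apply: W_rot; rewrite (_ : _ - _ = K) //; rewrite /K; ring.
have WK1 : W (K - 1) K.
  by apply: W_rot; rewrite (_ : _ - _ = K) //; rewrite /K; ring.
have row_K : forall i, W i K by apply: W_row WK1 _; rewrite subrK.
have col_K j : W K j by apply: W_rot.
have row_K2 : forall i, W i (K - 2).
  apply: (W_row K); first exact: col_K.
  apply: W_rot; rewrite (_ : _ - _ = K); [exact: col_K|rewrite /K; ring].
have col_K2 j : W (K - 2) j by apply: W_rot.
(* Columns [K - 2] and [K] settle two cells of row [j]; filling the gap at [K - 1] produces the
   adjacent pair that starts the row. *)
move: p.1 p.2 => i j; apply: (W_row (K - 1)); last by rewrite subrK.
apply: (W_line (K - 1) (K - 2) K) => //.
rewrite subrK -addrA perm_cons; exact/permPl/(perm_rev [:: _; _]).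
Qed.

Theorem theorem25 :
  (forall k : nat, (1 <= k)%N ->
     (Z3_signed_tileable (3 * k) <-> exists r : int, k%:Z = 9 * r))
  /\ (Z3_signed_tileable 27
      /\ forall k : nat, (1 <= k)%N ->
           Z3_signed_tileable (3 * k) -> (27 <= 3 * k)%N).
Proof.
have tileable k : Z3_signed_tileable (3 * k) <-> exists r : int, k%:Z = 9 * r.
  have S8 := sum_weight_fund_domain k.
  split=> [/tileable_weight[z Sz]|[r kr]].
    rewrite {}Sz in S8; set K := k%:Z in S8 *.
    (* (3 K + 2) (5 - 3 K) = 1 modulo 9 *)
    exists ((K ^+ 3 * (3 * K + 2) - 8 * z) * (5 - 3 * K)
      - K * (1 + K - K ^+ 2)).
    transitivity (K
      - (8 * (9 * z) - K * (9 * K * K - 1) * (3 * K + 2)) * (5 - 3 * K)).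
      by rewrite S8 subrr mul0r subr0.
    ring.
  have [z Sz] : exists z : int, \sum_(h <- fund_domain k) weight k h = 9 * z.
    (* With [S] the sum, [S = 9 S - 8 S], and [k = 9 r] puts a factor 9 in the closed form of
       [8 S]. *)
    exists (\sum_(h <- fund_domain k) weight k h
      - r * (9 * k%:Z * k%:Z - 1) * (3 * k%:Z + 2)).
    rewrite mulrBr !mulrA -kr -S8; ring.
  apply: orb3_span_tileable.
  (* Replacing each representative by its weight times the orbit of [(k, k)] leaves [9 * z] times
     that orbit. *)
  apply: (orb3_span_lin (a := z) (f := fun h => 9 * orb (3 * k) (k%:Z, k%:Z) h)
    (g := fun h => \sum_(r <- fund_domain k)
       (orb (3 * k) r h - weight k r * orb (3 * k) (k%:Z, k%:Z) h))).
  - exact: orb3_span_9orb.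
  - elim: (fund_domain k) => [|q s IHs].
      by exists [::] => h; rewrite !big_nil.
    apply: (orb3_span_lin (a := 1) (orb_equiv_weight k q) IHs) => h.
    by rewrite big_cons mul1r.
  move=> h; rewrite triangle_orb sumrB -mulr_suml Sz; ring.
split=> [k _|]; first exact: tileable.
split=> [|k k_gt0 /tileable[r]]; last lia.
by apply/(tileable 9%N); exists 1.
Qed.
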